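(* Let $M \in \mathbb{R}^{m \times n}$. The following statements are equivalent: (i) $\operatorname{rank}(M) = \operatorname{rank}_s(M)$. (ii) There exists a non-zero vector $z \in \mathbb{R}^m$ such that $M(:,j)^T z > 0$ for all $j$ such that $M(:,j) \neq 0$. In other terms, all non-zero columns of $M$ belong to the interior of a half space $\mathcal{P}_z = \{ x \in \mathbb{R}^m \mid x^T z \geq 0 \}$ for some $z \neq 0$, or, equivalently, there exists a positive vector in the row space of $M$ after its zero columns have been removed. (iii) Given any factorization $(A,B) \in \mathbb{R}^{m \times r} \times \mathbb{R}^{r \times n}$ of $M = AB$ with $r = \operatorname{rank}(M)$, all non-zero columns of $B$ belong to the interior of a half space $\mathcal{P}_y$ for some $y \neq 0$.
   Context: $M(:,j)$ denotes the $j$th column of $M$. $\operatorname{rank}(M)$ is the usual rank of $M$. The semi-nonnegative rank $\operatorname{rank}_s(M)$ is the smallest $r$ such that there exist $U \in \mathbb{R}^{m \times r}$ and $V \in \mathbb{R}^{r \times n}$ with $M = UV$ and $V \geq 0$, where $V \geq 0$ means that $V$ is component-wise nonnegative. A positive vector is one all of whose entries are strictly positive. For $y \in \mathbb{R}^r$, $\mathcal{P}_y = \{ x \in \mathbb{R}^r \mid x^T y \geq 0 \}$.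
   Formalization: In (iii) the factorizations are required to have r > 0 (m > 0 is also assumed): for M = 0 one has r = 0 and no non-zero y exists in R^0, so (iii) would fail although (i) and (ii) hold; for M ≠ 0 nothing changes. *)

(* Defs.v *)
From HB Require Import structures.
From mathcomp Require Import all_boot all_order all_algebra.
From mathcomp Require Import all_classical all_reals all_analysis.

Set Implicit Arguments.
Unset Strict Implicit.
Unset Printing Implicit Defensive.

Import Order.TTheory GRing.Theory Num.Theory.
Import numFieldNormedType.Exports.

Local Open Scope classical_set_scope.
Local Open Scope ring_scope.

Definition has_snn_factorization (R : realType) (m n : nat) (M : 'M[R]_(m, n))
    (r : nat) : Prop :=
  exists (U : 'M[R]_(m, r)) (V : 'M[R]_(r, n)),
    M = U *m V /\ forall k j, 0 <= V k j.

Lemma ex_snn_factorization (R : realType) (m n : nat) (M : 'M[R]_(m, n)) :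
  exists r, `[< has_snn_factorization M r >].
Proof.
exists n; apply/asboolP; exists M, 1%:M; split; first by rewrite mulmx1.
by move=> k j; rewrite mxE ler0n.
Qed.

Definition snn_rank (R : realType) (m n : nat) (M : 'M[R]_(m, n)) : nat :=
  ex_minn (ex_snn_factorization M).

Definition half_space (R : realType) (d : nat) (y : 'cV[R]_d) : set 'cV[R]_d :=
  [set x | 0 <= (x^T *m y) 0 0].

Definition nonzero_cols (R : realType) (m n : nat) (M : 'M[R]_(m, n)) :
    {set 'I_n} :=
  [set j | col j M != 0]%SET.

Definition drop_zero_cols (R : realType) (m n : nat) (M : 'M[R]_(m, n)) :
    'M[R]_(m, #|nonzero_cols M|) :=
  colsub (@enum_val _ (mem (nonzero_cols M))) M.

(* [°] is the topological interior, for the product topology of R^d carried by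
   ['cV[R]_d]. *)
Definition nonzero_cols_in_half_space_interior (R : realType) (d n : nat)
    (B : 'M[R]_(d, n)) : Prop :=
  exists y : 'cV[R]_d, y != 0 /\
    forall j, col j B != 0 -> (half_space y)° (col j B).

(* Main.v *)
(** A linear functional [w], positive on the nonzero columns of a full row rank
    factor [B], makes [B] nonnegative after the invertible change of basis
    [1 + t e w], where [e] is the all-ones column and [t] is large. Conversely,
    if [M = U V] with [U] of full column rank and [V >= 0], a functional equal
    to [1] on every column of [U] sends each column of [M] to the sum of the
    entries of the corresponding column of [V]. *)
Require Import Defs.
From mathcomp Require Import all_boot all_order all_algebra.
From mathcomp Require Import all_classical all_reals all_analysis.

Import Order.TTheory GRing.Theory Num.Theory.
Import numFieldNormedType.Exports.

Local Open Scope classical_set_scope.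
Local Open Scope ring_scope.

Lemma dotE {R : realType} {d : nat} (x y : 'cV[R]_d) :
  (x^T *m y) 0 0 = \sum_i x i 0 * y i 0.
Proof. by rewrite mxE; apply: eq_bigr => i _; rewrite mxE. Qed.

Lemma dot_colE {R : realType} {d n : nat} (B : 'M[R]_(d, n)) (y : 'cV[R]_d) j :
  ((col j B)^T *m y) 0 0 = (y^T *m B) 0 j.
Proof. by rewrite dotE mxE; apply: eq_bigr => i _; rewrite !mxE mulrC. Qed.

Lemma dotvv_gt0 {R : realType} {d : nat} (y : 'cV[R]_d) :
  y != 0 -> 0 < (y^T *m y) 0 0.
Proof.
have sq_ge0 i : true -> 0 <= y i 0 * y i 0 by rewrite -expr2 sqr_ge0.
move=> y0; rewrite dotE lt_def sumr_ge0 // andbT.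
apply: contra y0 => /eqP sum0; apply/eqP/colP => i; rewrite mxE.
by apply/eqP; rewrite -sqrf_eq0 expr2 (psumr_eq0P sq_ge0 sum0).
Qed.

Lemma dot_continuous {R : realType} {d : nat} (y : 'cV[R]_d) :
  continuous (fun x : 'cV[R]_d => (x^T *m y) 0 0).
Proof.
under eq_fun do rewrite dotE.
move=> x; apply: (@cvg_big _ _ _ _ _ add_continuous _ (nbhs x)) => i _.
by apply: (@cvgMr_tmp _ _ (nbhs x)); exact: coord_continuous.
Qed.

(** An interior point stays in the half space after a short move to [x - t *: y] with [t > 0], so
    its product with [y] is at least [t] times the squared length of [y]. The converse is
    continuity. *)
Lemma half_space_interiorE {R : realType} {d : nat} (x y : 'cV[R]_d) :
  y != 0 -> (half_space y)° x <-> 0 < (x^T *m y) 0 0.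
Proof.
move=> y0; split=> [xy|xy]; last first.
  have : \forall z \near x, 0 < (z^T *m y) 0 0.
    exact: (dot_continuous y x _ (lt_nbhsr xy)).
  by rewrite /interior /=; apply: filterS => z /ltW.
have cvg_x : x - t *: y @[t --> (0 : R)^'+] --> x.
  rewrite -[X in _ --> X]subr0 -(scale0r y).
  apply: (@cvg_at_right_filter _ _ (fun t => x - t *: y)).
  apply: cvgB; first exact: cvg_cst.
  exact: scalel_continuous.
have near_ge0 : \forall t \near (0 : R)^'+, half_space y (x - t *: y).
  exact: (cvg_x _ xy).
near ((0 : R)^'+) => t.
have t0 : 0 < t by [].
have : half_space y (x - t *: y) by near: t.
rewrite /half_space /= linearB linearZ /= mulmxBl -scalemxAl.
rewrite [X in 0 <= X]mxE [X in _ + X]mxE [X in _ - X]mxE subr_ge0.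
by apply: lt_le_trans; apply: mulr_gt0 => //; exact: dotvv_gt0.
Unshelve. all: by end_near.
Qed.

Definition pos_on_cols {R : realType} {d n : nat} (w : 'rV[R]_d)
    (B : 'M[R]_(d, n)) : Prop :=
  forall j, col j B != 0 -> 0 < (w *m B) 0 j.

(** If [w = 0] works, then [B] has no nonzero column, and any other vector works too. *)
Lemma pos_on_cols_neq0 {R : realType} {d n : nat} (w : 'rV[R]_d)
    (B : 'M[R]_(d, n)) :
  (0 < d)%N -> pos_on_cols w B -> exists2 w', w' != 0 & pos_on_cols w' B.
Proof.
case: d w B => // d w B _ wB; have [w0|w0] := eqVneq w 0; last by exists w.
exists (const_mx 1) => [|j /wB]; last by rewrite w0 mul0mx mxE ltxx.
by apply/eqP => /rowP /(_ 0) /eqP; rewrite !mxE oner_eq0.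
Qed.

Lemma half_space_interior_pos {R : realType} {d n : nat} (B : 'M[R]_(d, n)) :
  (0 < d)%N ->
  nonzero_cols_in_half_space_interior B <-> exists w, pos_on_cols w B.
Proof.
move=> d0; split=> [[y [y0 yB]]|[w /(pos_on_cols_neq0 _ _ d0) [{}w w0 wB]]].
  exists y^T => j /yB /half_space_interiorE; rewrite dot_colE; exact.
have wT0 : w^T != 0 by rewrite trmx_eq0.
exists w^T; split=> // j /wB Bj; apply/half_space_interiorE => //.
by rewrite dot_colE trmxK.
Qed.

Lemma snn_rank_le {R : realType} {m n r : nat} (M : 'M[R]_(m, n)) :
  has_snn_factorization M r -> (snn_rank M <= r)%N.
Proof.
by move=> Mr; rewrite /snn_rank; case: ex_minnP => k _; apply; apply/asboolP.
Qed.

Lemma snn_rankP {R : realType} {m n : nat} (M : 'M[R]_(m, n)) :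
  has_snn_factorization M (snn_rank M).
Proof. by rewrite /snn_rank; case: ex_minnP => k /asboolP. Qed.

Lemma rank_le_snn_rank {R : realType} {m n : nat} (M : 'M[R]_(m, n)) :
  (\rank M <= snn_rank M)%N.
Proof.
have [U [V [defM _]]] := snn_rankP M; rewrite {1}defM.
exact: leq_trans (mxrankM_maxl _ _) (rank_leq_col _).
Qed.

Lemma row_full_snn_pos {R : realType} {m n r : nat} (U : 'M[R]_(m, r))
    (V : 'M[R]_(r, n)) :
  row_full U -> (forall k j, 0 <= V k j) -> exists w, pos_on_cols w (U *m V).
Proof.
move=> /row_fullP [L LU] V0; exists (const_mx 1 *m L) => j UVj.
rewrite mulmxA -(mulmxA _ L) LU mulmx1 mxE.
under eq_bigr do rewrite mxE mul1r.
(* Nonnegative entries with sum zero all vanish, which would make column [j] of the product zero. *)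
rewrite lt_def sumr_ge0 // andbT; apply: contra UVj => /eqP sum0.
rewrite colE -mulmxA -colE; suff -> : col j V = 0 by rewrite mulmx0.
by apply/colP => k; rewrite !mxE (psumr_eq0P (fun k _ => V0 k j) sum0).
Qed.

(** A left inverse makes [A] injective, so it sends nonzero columns of [B] to nonzero columns of
    [A *m B]. *)
Lemma pos_on_cols_factor {R : realType} {m n r : nat} (A : 'M[R]_(m, r))
    (B : 'M[R]_(r, n)) (w : 'rV[R]_m) :
  row_full A -> pos_on_cols w (A *m B) -> pos_on_cols (w *m A) B.
Proof.
move=> /row_fullP [L LA] wAB j Bj; rewrite -mulmxA; apply: wAB.
apply: contra Bj => /eqP ABj; rewrite -[col j B]mul1mx -LA -mulmxA colE.
by rewrite (mulmxA A) -colE ABj mulmx0.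
Qed.

Lemma pos_on_cols_snn {R : realType} {n r : nat} (B : 'M[R]_(r, n))
    (w : 'rV[R]_r) :
  pos_on_cols w B -> exists2 G, G \in unitmx & forall k j, 0 <= (G *m B) k j.
Proof.
move=> wB; pose e : 'cV[R]_r := const_mx 1; pose s := (w *m e) 0 0.
(* The absolute values make every term nonnegative, so [T] dominates each single ratio. *)
pose T := \sum_j \sum_i `|B i j| / `|(w *m B) 0 j|.
(* [1 + t * s] is the determinant of [1 + t e w]. It cannot vanish at both [T] and [T + 1]: that
   would give [s = 0], hence [1 = 0]. *)
have [t tT ts] : exists2 t, T <= t & 1 + t * s != 0.
  have [ts|] := eqVneq (1 + T * s) 0; last by exists T.
  exists (T + 1); first by rewrite lerDl.
  rewrite mulrDl addrA ts add0r mul1r; apply/eqP => s0.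
  by move/eqP: ts; rewrite s0 mulr0 addr0 oner_eq0.
have weE : w *m e = s%:M by rewrite [LHS]mx11_scalar.
exists (1%:M + t *: (e *m w)) => [|k j].
  (* This is the Sherman-Morrison inverse of a rank-one update. *)
  pose H := 1%:M - (t / (1 + t * s)) *: (e *m w).
  suff /mulmx1_unit[] : (1%:M + t *: (e *m w)) *m H = 1%:M by [].
  rewrite /H mulmxBr mulmx1 -scalemxAr mulmxDl mul1mx -scalemxAl.
  rewrite -mulmxA (mulmxA w) weE mul_scalar_mx -scalemxAr scalerA.
  rewrite -{2}(scale1r (e *m w)) -scalerDl scalerA divfK //.
  exact: addrK.
rewrite mulmxDl mul1mx -scalemxAl -mulmxA mxE [X in _ + X]mxE.
rewrite [(e *m _) _ _]mxE big_ord1 [e _ _]mxE mul1r.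
have [/colP Bj|/wB Bj] := eqVneq (col j B) 0.
  have B0 i : B i j = 0 by have := Bj i; rewrite !mxE.
  rewrite B0 add0r mxE big1 ?mulr0 // => i _.
  by rewrite B0 mulr0.
rewrite addrC -lerBlDr sub0r; apply: le_trans (ler_norm _) _; rewrite normrN.
rewrite -ler_pdivrMr //; apply: le_trans tT.
rewrite -{1}(gtr0_norm Bj) /T (bigD1 j) //= (bigD1 k) //= -addrA lerDl.
by rewrite addr_ge0 ?sumr_ge0 // => i _; rewrite sumr_ge0.
Qed.

Theorem theorem2 (R : realType) (m n : nat) (m_gt0 : (0 < m)%N)
    (M : 'M[R]_(m, n)) :
  [<-> (* (i) *)
       \rank M = snn_rank M;
       (* (ii) *)
       exists z : 'cV[R]_m, z != 0 /\
         forall j, col j M != 0 -> 0 < ((col j M)^T *m z) 0 0;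
       (* (ii), in terms of half spaces *)
       nonzero_cols_in_half_space_interior M;
       (* (ii), in terms of the row space *)
       exists v : 'rV[R]_#|nonzero_cols M|,
         (v <= drop_zero_cols M)%MS /\ forall k, 0 < v 0 k;
       (* (iii) *)
       forall (r : nat) (A : 'M[R]_(m, r)) (B : 'M[R]_(r, n)),
         (0 < r)%N -> r = \rank M -> M = A *m B ->
         nonzero_cols_in_half_space_interior B ].
Proof.
tfae.
- move=> rM; have [U [V [defM V0]]] := snn_rankP M.
  have fullU : row_full U.
    (* [U] has [\rank M] columns and at least the rank of [M], so its columns are independent. *)
    by rewrite /row_full eqn_leq rank_leq_col -{1}rM {1}defM mxrankM_maxl.
  have [w] := row_full_snn_pos U V fullU V0; rewrite -defM.
  move=> /(pos_on_cols_neq0 _ _ m_gt0) [w' w'0 w'M].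
  exists w'^T; rewrite trmx_eq0; split=> // j /w'M.
  by rewrite dot_colE trmxK.
- move=> [z [z0 zM]]; exists z; split=> // j /zM ?.
  exact/half_space_interiorE.
- move=> /(half_space_interior_pos _ m_gt0) [w wM].
  exists (w *m drop_zero_cols M); split=> [|k]; first exact: submxMl.
  rewrite /drop_zero_cols mulmx_colsub mxE; apply: wM.
  by have := enum_valP k; rewrite inE.
- move=> [v [/submxP [w ->] wM]] r A B r0 rE defM.
  apply/half_space_interior_pos => //; exists (w *m A).
  apply: pos_on_cols_factor; rewrite -?defM.
    by rewrite /row_full eqn_leq rank_leq_col {1}rE defM mxrankM_maxl.
  move=> j Mj; have jM : j \in nonzero_cols M by rewrite inE.
  have := wM (enum_rank_in jM j).
  by rewrite /drop_zero_cols mulmx_colsub mxE enum_rankK_in.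
- move=> posB; apply/eqP; rewrite eqn_leq rank_le_snn_rank; apply: snn_rank_le.
  have [w wB] : exists w, pos_on_cols w (row_base M).
    (* [posB] covers positive rank only. In rank zero [row_base M] has no rows, so all its columns
       are zero. *)
    have [r0|r0] := posnP (\rank M).
      exists 0 => j; suff -> : col j (row_base M) = 0 by rewrite eqxx.
      by apply/matrixP => i; have := ltn_ord i; rewrite {2}r0.
    apply/half_space_interior_pos => //.
    by apply: (posB _ (col_base M)) => //; rewrite mulmx_base.
  have [G uG GB0] := pos_on_cols_snn _ _ wB.
  (* Inserting [invmx G *m G] into the rank factorization keeps the inner dimension [\rank M]. *)
  exists (col_base M *m invmx G), (G *m row_base M); split=> //.
  by rewrite -mulmxA mulKmx // mulmx_base.
Qed.
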